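(* Let $n\ge 4$. Let $S_n$ be the star on $n$ vertices and let $S_{n-3,1}$ be the tree on $n$ vertices consisting of a vertex $u$ adjacent to $n-3$ leaves and to one further vertex $w$ of degree $2$ whose other neighbor is a leaf. Then for every tree $T$ on $n$ vertices with $T\not\cong S_n$ and $T\not\cong S_{n-3,1}$, $$\rho_{ABC}(T)<\rho_{ABC}(S_{n-3,1})<\rho_{ABC}(S_n).$$
   Context: For a simple connected graph $G$ with vertex set $\{v_1,\dots,v_n\}$ and degrees $d_i$, the ABC matrix is $M(G)=(m_{ij})_{n\times n}$ with $m_{ij}=\sqrt{(d_i+d_j-2)/(d_id_j)}$ if $v_iv_j$ is an edge and $m_{ij}=0$ otherwise. The ABC spectral radius $\rho_{ABC}(G)$ is the largest eigenvalue of $M(G)$. The tree $S_{n-3,1}$ (a double star) is the unique tree on $n$ vertices with maximum degree $n-2$. *)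

(* Defs.v *)
From HB Require Import structures.
From mathcomp Require Import all_boot all_order all_algebra.
From mathcomp Require Import fingroup perm polyrcf.
Set Implicit Arguments. Unset Strict Implicit. Unset Printing Implicit Defensive.
Import Order.TTheory GRing.Theory Num.Theory.
Local Open Scope ring_scope.

Definition simple_graph (n : nat) (e : rel 'I_n) : Prop :=
  symmetric e /\ irreflexive e.

Definition connected_graph (n : nat) (e : rel 'I_n) : Prop :=
  forall x y : 'I_n, connect e x y.

Definition acyclic_graph (n : nat) (e : rel 'I_n) : Prop :=
  forall s : seq 'I_n, uniq s -> (3 <= size s)%N -> ~~ path.cycle e s.

Definition is_tree (n : nat) (e : rel 'I_n) : Prop :=
  simple_graph e /\ connected_graph e /\ acyclic_graph e.

Definition graph_iso (n : nat) (e1 e2 : rel 'I_n) : Prop :=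
  exists f : {perm 'I_n}, forall x y, e2 (f x) (f y) = e1 x y.

Definition deg (n : nat) (e : rel 'I_n) (i : 'I_n) : nat := #|[set j | e i j]|.

Definition ABC_matrix (R : rcfType) (n : nat) (e : rel 'I_n) : 'M[R]_n :=
  \matrix_(i, j) (if e i j then
     Num.sqrt (((deg e i)%:R + (deg e j)%:R - 2) / ((deg e i)%:R * (deg e j)%:R))
   else 0).

(* largest (real) eigenvalue: the largest real root of the characteristic
   polynomial ('rootsR' is the increasingly sorted list of real roots). *)
Definition spectral_radius (R : rcfType) (n : nat) (M : 'M[R]_n) : R :=
  last 0 (rootsR (char_poly M)).

Definition rho_ABC (R : rcfType) (n : nat) (e : rel 'I_n) : R :=
  spectral_radius (ABC_matrix R e).

Definition star_graph (n : nat) : rel 'I_n :=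
  fun x y => ((val x == 0%N) && (val y != 0%N)) || ((val y == 0%N) && (val x != 0%N)).

Definition S31_adj (a b : nat) : bool :=
  ((a == 0%N) && ((b == 1%N) || (3 <= b)%N)) || ((a == 1%N) && (b == 2%N)).

Definition S31_graph (n : nat) : rel 'I_n :=
  fun x y => S31_adj (val x) (val y) || S31_adj (val y) (val x).
Arguments star_graph n : clear implicits.
Arguments S31_graph n : clear implicits.

(* Main.v *)
Require Import Defs.
From HB Require Import structures.
From mathcomp Require Import all_boot all_order all_algebra.
From mathcomp Require Import fingroup perm polyrcf.
From mathcomp Require Import ring lra zify.
Import Order.TTheory GRing.Theory Num.Theory.
Local Open Scope ring_scope.

(** If rho > 0 is an eigenvalue of the ABC matrix with eigenvector z, then at a
    vertex i maximizing |z_i| / sqrt d_i the eigenvalue equation gives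
    rho d_i <= sum_(j ~ i) sqrt (d_i + d_j - 2), and AM-GM turns this into
    rho^2 <= d_i - 2 + (sum_(j ~ i) d_j) / d_i. A graph without triangles and
    4-cycles satisfies sum_(j ~ i) d_j <= n - 1.  Writing m = n - 3, a tree with
    maximum degree at most m therefore has rho^2 <= m - 1 + 2 / m (for m >= 2),
    while rho(S_{n-3,1})^2 is at least a root >= m - 1 + 2 / m of an explicit
    quadratic.  Equality is only possible for m = 2; then the maximizing set is
    closed under taking neighbours and consists of vertices of degree 2, which
    forces a 5-cycle. *)

Set Implicit Arguments. Unset Strict Implicit. Unset Printing Implicit Defensive.

(** * The spectral radius as an eigenvalue *)

Lemma mem_rootsR (R : rcfType) (p : {poly R}) x :
  p != 0 -> (x \in rootsR p) = root p x.
Proof. by move=> /roots_on_rootsR <-; rewrite in_itv. Qed.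

Lemma mem_rootsR_char_poly (R : rcfType) n (M : 'M[R]_n) a :
  (a \in rootsR (char_poly M)) = eigenvalue M a.
Proof. by rewrite mem_rootsR ?eigenvalue_root_char ?monic_neq0 ?char_poly_monic. Qed.

(** The value 0 is also the default of [last] on an empty list of roots, so a nonzero value
    certifies that a root was found. *)
Lemma eigenvalue_spectral_radius (R : rcfType) n (M : 'M[R]_n) :
  spectral_radius M != 0 -> eigenvalue M (spectral_radius M).
Proof.
rewrite -mem_rootsR_char_poly /spectral_radius.
by case: (rootsR _) => [|x s _] /=; rewrite ?eqxx ?mem_last.
Qed.

Lemma eigenvalue_le_spectral_radius (R : rcfType) n (M : 'M[R]_n) a :
  eigenvalue M a -> a <= spectral_radius M.
Proof.
rewrite -mem_rootsR_char_poly /spectral_radius.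
have : sorted <%R (rootsR (char_poly M)) by apply: sorted_roots.
case: (rootsR _) => [|x s] //; rewrite sorted_pairwise; last exact: lt_trans.
rewrite lastI pairwise_rcons last_rcons mem_rcons inE.
by move=> /andP[/allP lt_last _] /orP[/eqP->|/lt_last/ltW].
Qed.

(** * Local bound on the eigenvalues of the ABC matrix *)

Section ABC.
Variables (R : rcfType) (n : nat) (e : rel 'I_n).
Hypothesis e_sym : symmetric e.
Let nd i : R := (deg e i)%:R.

Lemma ABC_sym i j : ABC_matrix R e i j = ABC_matrix R e j i.
Proof. by rewrite !mxE e_sym [X in X - 2]addrC [X in _ / X]mulrC. Qed.

Lemma sum_nbr_const (c : R) i : \sum_(j | e i j) c = nd i * c.
Proof.
rewrite sumr_const /nd /deg mulr_natl; congr (_ *+ _).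
by apply: eq_card => j; rewrite !inE.
Qed.

(** Symmetry of the matrix turns the row-vector equation into one equation per vertex, summed over
    its neighbours. *)
Lemma ABC_eigenvalueP (rho : R) :
  reflect (exists2 v : 'I_n -> R, (exists i, v i != 0) &
     forall i, rho * v i = \sum_(j | e i j) ABC_matrix R e i j * v j)
   (eigenvalue (ABC_matrix R e) rho).
Proof.
apply: (iffP eigenvalueP) => [[z zM z0]|[v [i vi0] vM]].
  exists (z 0) => [|i].
    by case/rV0Pn: z0 => i; exists i.
  have /rowP/(_ i) := zM; rewrite !mxE => <-.
  rewrite [RHS]big_mkcond /=; apply: eq_bigr => j _; rewrite mulrC ABC_sym.
  by rewrite mxE; case: ifP; rewrite ?mul0r.
exists (\row_j v j); last first.
  by apply/rV0Pn; exists i; rewrite mxE.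
apply/rowP => j; rewrite !mxE vM [RHS]big_mkcond /=; apply: eq_bigr => k _.
by rewrite ABC_sym mxE mulrC mxE; case: ifP; rewrite ?mul0r.
Qed.

Hypothesis deg_gt0 : forall i, (0 < deg e i)%N.

Lemma ABC_sqrt_deg i j : e i j ->
  ABC_matrix R e i j * Num.sqrt (nd j) * Num.sqrt (nd i) = Num.sqrt (nd i + nd j - 2).
Proof.
move=> eij; have [di dj] := (deg_gt0 i, deg_gt0 j).
have di1 : 1 <= nd i by rewrite ler1n.
have dj1 : 1 <= nd j by rewrite ler1n.
have m_ge0 : 0 <= (nd i + nd j - 2) / (nd i * nd j).
  by rewrite divr_ge0 ?mulr_ge0 //; lra.
rewrite mxE eij -/(nd i) -/(nd j) -!sqrtrM ?(mulr_ge0 m_ge0) //.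
congr Num.sqrt; field; apply/andP; split; lra.
Qed.

(** [S] is the set of maximizers of [|v i| / sqrt (nd i)]. The second conjunct is the equality case:
    a neighbour outside [S] would make the bound at [i] strict. *)
Lemma ABC_eigenvalue_local_bound (rho : R) :
  0 < rho -> eigenvalue (ABC_matrix R e) rho ->
  exists2 S : {set 'I_n}, S != set0 & forall i, i \in S ->
    rho ^+ 2 * nd i <= \sum_(j | e i j) (nd i + nd j - 2) /\
    (\sum_(j | e i j) (nd i + nd j - 2) <= rho ^+ 2 * nd i ->
      forall j, e i j -> j \in S).
Proof.
move=> rho_gt0 /ABC_eigenvalueP[v [i0 vi0] vM].
have d1 i : 1 <= nd i by rewrite ler1n.
have d0 i : 0 < Num.sqrt (nd i) by rewrite sqrtr_gt0; have := d1 i; lra.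
pose w i := `|v i| / Num.sqrt (nd i).
have wE i : `|v i| = w i * Num.sqrt (nd i) by rewrite divfK ?gt_eqF.
have w_ge0 i : 0 <= w i by rewrite divr_ge0 // ltW.
have w_i0 : 0 < w i0 by rewrite divr_gt0 // normr_gt0.
clearbody w.
(* The weights [w j] stay on the right, so that this inequality yields both the bound and its
   equality case. *)
have w_le i : 2 * rho ^+ 2 * nd i * w i <=
    \sum_(j | e i j) (rho ^+ 2 + (nd i + nd j - 2)) * w j.
  have h : rho * nd i * w i <=
      \sum_(j | e i j) Num.sqrt (nd i + nd j - 2) * w j.
    have -> : rho * nd i * w i = Num.sqrt (nd i) * `|rho * v i|.
      rewrite normrM (gtr0_norm rho_gt0) wE -{1}(@sqr_sqrtr _ (nd i)); first ring.
      by have := d1 i; lra.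
    rewrite vM (le_trans (ler_wpM2l (ltW (d0 i)) (ler_norm_sum _ _ _))) //.
    rewrite mulr_sumr; apply: ler_sum => j eij.
    rewrite -ABC_sqrt_deg // normrM wE ger0_norm; last first.
      by rewrite mxE eij sqrtr_ge0.
    rewrite le_eqVlt; apply/orP; left; apply/eqP; ring.
  have := ler_wpM2l (ltW rho_gt0) h.
  (* AM-GM: [2 rho sqrt s <= rho^2 + s] *)
  have h2 : 2 * (rho * \sum_(j | e i j) Num.sqrt (nd i + nd j - 2) * w j) <=
     \sum_(j | e i j) (rho ^+ 2 + (nd i + nd j - 2)) * w j.
    rewrite !mulr_sumr; apply: ler_sum => j eij.
    rewrite !mulrA; apply: ler_wpM2r => //.
    set s := nd i + _ - _; rewrite -{2}(@sqr_sqrtr _ s).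
      by have := sqr_ge0 (rho - Num.sqrt s); nra.
    by have := (d1 i, d1 j); rewrite /s => -[]; lra.
  by nra.
have [m w_max] : exists m, forall j, w j <= w m.
  by have [m _ w_max] := @arg_maxP _ _ _ i0 xpredT w isT; exists m => j; apply: w_max.
have w_m : 0 < w m by apply: lt_le_trans (w_max i0).
exists [set i | w i == w m].
  by apply/set0Pn; exists m; rewrite inE.
move=> i; rewrite inE => /eqP wi; have := w_le i; rewrite wi.
set S := \sum_(j | e i j) (nd i + nd j - 2) => wm_le.
have SE : \sum_(j | e i j) (rho ^+ 2 + (nd i + nd j - 2)) * w m =
    (rho ^+ 2 * nd i + S) * w m.
  by rewrite -mulr_suml big_split /= sum_nbr_const mulrC (mulrC (nd i)) mulrC.
(* Positive coefficients make a single neighbour with [w j < w m] decrease the whole sum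
   strictly. *)
have coef_gt0 j : 0 < rho ^+ 2 + (nd i + nd j - 2).
  by have := (exprn_gt0 2 rho_gt0, d1 i, d1 j) => -[[]]; lra.
have leS : \sum_(j | e i j) (rho ^+ 2 + (nd i + nd j - 2)) * w j <=
   (rho ^+ 2 * nd i + S) * w m.
  rewrite -SE; apply: ler_sum => j _; apply: ler_wpM2l; first exact/ltW.
  exact: w_max.
split.
  have := le_trans wm_le leS; rewrite ler_pM2r //; lra.
move=> S_le j eij; rewrite inE eq_le w_max //= leNgt; apply/negP => wj.
have : \sum_(j | e i j) (rho ^+ 2 + (nd i + nd j - 2)) * w j <
   (rho ^+ 2 * nd i + S) * w m.
  rewrite -SE (bigD1 j) //= [ltRHS](bigD1 j) //=; apply: ltr_leD.
    by rewrite ltr_pM2l.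
  apply: ler_sum => k _; apply: ler_wpM2l; first exact/ltW.
  exact: w_max.
by nra.
Qed.

End ABC.

(** * Acyclic graphs: counting walks, and vertices of degree n - 1 or n - 2 *)

Section Trees.
Variables (n : nat) (e : rel 'I_n).
Hypotheses (e_sym : symmetric e) (e_irr : irreflexive e).

Lemma adj_neq x y : e x y -> x != y.
Proof. by apply: contraTneq => ->; rewrite e_irr. Qed.

Lemma exists_nbr x y : connect e x y -> x != y -> exists z, e x z.
Proof.
by case/connectP=> [[|z p] /= ep ->]; rewrite ?eqxx // => _; exists z; case/andP: ep.
Qed.

Lemma deg_gt0P i : reflect (exists j, e i j) (0 < deg e i)%N.
Proof.
rewrite /deg card_gt0; apply: (iffP (set0Pn _)) => -[j]; rewrite ?inE => eij; exists j => //.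
by rewrite inE.
Qed.

Lemma deg_lt i : (deg e i < n)%N.
Proof.
rewrite -[X in (_ < X)%N]card_ord -cardsT; apply: proper_card; apply/properP.
by split; [apply: subsetT | exists i; rewrite !inE ?e_irr].
Qed.

Hypothesis e_acyclic : acyclic_graph e.

Lemma no_triangle x y z : e x y -> e y z -> e z x = false.
Proof.
move=> exy eyz; apply/negP => ezx.
have /negP[] : ~~ path.cycle e [:: x; y; z].
  apply: e_acyclic => //=.
  by rewrite !inE negb_or (adj_neq exy) (adj_neq eyz) eq_sym (adj_neq ezx).
by rewrite /= exy eyz ezx.
Qed.

Lemma no_square x y z t : e x y -> e y z -> e z t -> e t x -> x = z \/ y = t.
Proof.
move=> exy eyz ezt etx; have [|xz] := eqVneq x z; first by left.
have [|yt] := eqVneq y t; first by right.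
have /negP[] : ~~ path.cycle e [:: x; y; z; t].
  apply: e_acyclic => //=.
  by rewrite !inE !negb_or (adj_neq exy) (adj_neq eyz) (adj_neq ezt) xz yt
    eq_sym (adj_neq etx).
by rewrite /= exy eyz ezt etx.
Qed.

(** The sum counts walks of length two from [i]; without triangles and squares they inject into the
    vertices other than [i]. *)
Lemma sum_nbr_deg_lt i : (\sum_(j | e i j) deg e j < n)%N.
Proof.
pose P := [set p : 'I_n * 'I_n | e i p.1 && e p.1 p.2].
have -> : (\sum_(j | e i j) deg e j = #|P|)%N.
  rewrite -sum1_card; under eq_bigr do rewrite /deg -sum1_card.
  rewrite pair_big_dep /=; apply: eq_bigl => -[j k]; by rewrite !inE.
(* a walk i - j - k is sent to k, except that i - j - i is sent to j *)
pose f (p : 'I_n * 'I_n) := if p.2 == i then p.1 else p.2.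
have f_inj : {in P &, injective f}.
  move=> [j k] [j' k']; rewrite !inE /f /= => /andP[eij ejk] /andP[eij' ejk'].
  case: eqVneq ejk => [-> _|ki ejk]; case: eqVneq ejk' => [-> _|k'i ejk'] ff.
  - by rewrite ff.
  - by move: (no_triangle eij' ejk'); rewrite -ff e_sym eij.
  - by move: (no_triangle eij ejk); rewrite ff e_sym eij'.
  - subst k'; have [/eqP|->//] : i = k \/ j = j'.
      by apply: (no_square eij ejk); rewrite e_sym.
    by rewrite eq_sym (negPf ki).
rewrite -(card_in_imset f_inj) -[X in (_ < X)%N]card_ord -cardsT.
apply: proper_card; apply/properP; split; first exact: subsetT.
exists i => //; apply/imsetP => -[[j k]]; rewrite inE /f /= => /andP[eij ejk].
case: eqVneq => [_ ij|ki ik]; last by rewrite -ik eqxx in ki.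
by rewrite -ij e_irr in eij.
Qed.

(** [c] is adjacent to all other vertices, and an edge between two of those would close a
    triangle. *)
Lemma star_of_deg c : deg e c = n.-1 -> graph_iso e (star_graph n).
Proof.
move=> dc.
have ec x : e c x = (x != c).
  have : [set j | e c j] = [set~ c].
    apply/eqP; rewrite eqEcard cardsC1 card_ord -dc leqnn andbT.
    by apply/subsetP => j; rewrite !inE eq_sym => /adj_neq.
  by move/setP/(_ x); rewrite !inE.
have n0 : (0 < n)%N by case: (c) => m; case: (n).
pose o0 := Ordinal n0; exists (tperm c o0) => x y.
have val0 z : (val (tperm c o0 z) == 0%N) = (z == c).
  by rewrite -[0%N]/(val o0) val_eqE -(inj_eq (@perm_inj _ (tperm c o0)) z) tpermL.
rewrite /star_graph !val0.
have [->|xc] := eqVneq x c; first by rewrite ec andbF orbF.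
have [->|yc] := eqVneq y c; first by rewrite e_sym ec xc.
apply/esym/negP => exy; have := @no_triangle c x y.
by rewrite ec xc exy e_sym ec yc => /(_ isT isT).
Qed.

(** [c] misses exactly one vertex [b]. A second neighbour of [b] besides [a] would close a square
    through [c], and an edge between two neighbours of [c] a triangle. *)
Lemma S31_of_deg c : (2 < n)%N -> (forall i, 0 < deg e i)%N ->
  deg e c = n.-2 -> graph_iso e (S31_graph n).
Proof.
move=> n3 e_deg dc.
have [b bc ec] : exists2 b, b != c & forall x, e c x = (x != c) && (x != b).
  have : #|~: [set j | e c j] :\ c| = 1%N.
    have := cardsC [set j | e c j]; rewrite -/(deg e c) dc card_ord.
    rewrite (cardsD1 c (~: _)) !inE e_irr /=; lia.
  move/eqP/cards1P => [b bE].
  have : b \in ~: [set j | e c j] :\ c by rewrite bE inE.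
  rewrite !inE => /andP[bc _]; exists b => // x.
  move/setP/(_ x): bE; rewrite !inE.
  case: eqVneq => [->|xc] /=; first by rewrite e_irr.
  by move=> <-; rewrite negbK.
have [a eba] := deg_gt0P _ (e_deg b).
have ab : a != b by rewrite eq_sym (adj_neq eba).
have ac : a != c.
  by apply: contraTneq eba => ->; rewrite e_sym ec eqxx andbF.
have eb x : e b x = (x == a).
  apply/idP/eqP => [ebx|->//].
  have xb : x != b by rewrite eq_sym (adj_neq ebx).
  have xc : x != c by apply: contraTneq ebx => ->; rewrite e_sym ec eqxx andbF.
  have ecx : e c x by rewrite ec xc.
  have exb : e x b by rewrite e_sym.
  have eac : e a c by rewrite e_sym ec ac.
  have [/eqP|->//] := no_square ecx exb eba eac.
  by rewrite eq_sym (negPf bc).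
(* The relabelling sends [c], [a], [b] to 0, 1, 2 by successive transpositions, each fixing the
   labels already placed. *)
pose o0 := Ordinal (ltnW (ltnW n3)); pose o1 := Ordinal (ltnW n3); pose o2 := Ordinal n3.
pose p1 := tperm c o0; pose p2 := (p1 * tperm (p1 a) o1)%g.
pose p3 := (p2 * tperm (p2 b) o2)%g.
have p1c : p1 c = o0 by rewrite tpermL.
have p1a : p1 a != o0 by rewrite -p1c (inj_eq perm_inj).
have p2c : p2 c = o0 by rewrite permM p1c tpermD.
have p2a : p2 a = o1 by rewrite permM tpermL.
have p2b0 : p2 b != o0 by rewrite -p2c (inj_eq perm_inj).
have p2b1 : p2 b != o1 by rewrite -p2a (inj_eq perm_inj) eq_sym.
have p3c : p3 c = o0 by rewrite permM p2c tpermD.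
have p3a : p3 a = o1 by rewrite permM p2a tpermD.
have p3b : p3 b = o2 by rewrite permM tpermL.
exists p3 => x y.
have v0 z : (val (p3 z) == 0%N) = (z == c).
  by rewrite -[0%N]/(val o0) val_eqE -p3c (inj_eq perm_inj).
have v1 z : (val (p3 z) == 1%N) = (z == a).
  by rewrite -[1%N]/(val o1) val_eqE -p3a (inj_eq perm_inj).
have v2 z : (val (p3 z) == 2%N) = (z == b).
  by rewrite -[2%N]/(val o2) val_eqE -p3b (inj_eq perm_inj).
have v3 z : (2 < val (p3 z))%N = [&& z != c, z != a & z != b].
  by rewrite -v0 -v1 -v2; case: (val _) => [|[|[|]]].
rewrite /S31_graph /S31_adj !v0 !v1 !v2 !v3.
have ca : (c == a) = false by rewrite eq_sym (negPf ac).
have cb : (c == b) = false by rewrite eq_sym (negPf bc).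
have ec_S31 z :
    e c z = (z == a) || [&& z != c, z != a & z != b].
  rewrite ec; have [->|_] := eqVneq z a; first by rewrite ac ab.
  by case: (z == c); case: (z == b).
have [->|xc] := eqVneq x c; first by rewrite ec_S31 ca cb /= !andbF !orbF.
have [->|yc] := eqVneq y c; first by rewrite e_sym ec_S31 ca cb /= !andbF (negPf xc) /= !orbF.
have [->|xb] := eqVneq x b; first by rewrite eb (eq_sym b) (negPf ab) andbT.
have [->|yb] := eqVneq y b; first by rewrite e_sym eb andbT (eq_sym b) (negPf ab) orbF.
rewrite /= !andbF; apply/esym/negP => exy; have := @no_triangle c x y.
by rewrite ec xc xb exy e_sym ec yc yb => /(_ isT isT).
Qed.

End Trees.

(** * The equality case on five vertices *)

Section FiveVertices.
Variables (n : nat) (e : rel 'I_n).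
Hypotheses (e_sym : symmetric e) (e_irr : irreflexive e).

Lemma deg2_nbrs x y : deg e x = 2%N -> e x y ->
  exists2 z, z != y & forall t, e x t = (t == y) || (t == z).
Proof.
move=> dx exy; have : #|[set t | e x t] :\ y| = 1%N.
  by move: dx; rewrite /deg (cardsD1 y) inE exy => -[].
move/eqP/cards1P => [z zE].
have : z \in [set t | e x t] :\ y by rewrite zE inE.
rewrite !inE => /andP[zy exz]; exists z => // t.
by move/setP/(_ t): zE; rewrite !inE; case: eqVneq => [->|].
Qed.

Lemma second_nbr_deg2 i j : e i j -> deg e i = 2%N -> deg e j = 2%N ->
  (\sum_(k | e j k) deg e k)%N = 4%N ->
  exists2 k, k != i & e j k /\ deg e k = 2%N.
Proof.
move=> eij di dj; have [|k ki ej] := @deg2_nbrs j i dj; first by rewrite e_sym.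
under eq_bigl do rewrite ej.
rewrite (bigD1 i) ?eqxx //= (bigD1 k) ?eqxx ?orbT //= big1 => [|t]; last first.
  by case: (t == i); case: (t == k).
by rewrite di => s4; exists k; rewrite // ej eqxx orbT; split=> //; lia.
Qed.

Hypothesis e_acyclic : acyclic_graph e.

(** Following degree 2 vertices from [i] in both directions gives the path j' - j - i - k - k' on
    all five vertices. The other neighbour [t] of [j'] lies on it: [k'] closes a 5-cycle, [i] a
    triangle, [k] a square. *)
Lemma deg2_ball_false i : n = 5%N -> deg e i = 2%N ->
  (forall j, e i j -> deg e j = 2%N /\ (\sum_(k | e j k) deg e k)%N = 4%N) ->
  False.
Proof.
move=> n5 di nbrs.
have [j eij] : exists j, e i j by apply/deg_gt0P; rewrite di.
have [k kj ei] := deg2_nbrs di eij.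
have eik : e i k by rewrite ei eqxx orbT.
have [[dj sj] [dk sk]] := (nbrs j eij, nbrs k eik).
have [j' j'i [ejj' dj']] := second_nbr_deg2 eij di dj sj.
have [k' k'i [ekk' dk']] := second_nbr_deg2 eik di dk sk.
have ej'j : e j' j by rewrite e_sym.
have [t tj et] := deg2_nbrs dj' ej'j.
have ej't : e j' t by rewrite et eqxx orbT.
have eki : e k i by rewrite e_sym.
have ek'k : e k' k by rewrite e_sym.
have [tri sq] := (no_triangle e_irr e_acyclic, no_square e_irr e_acyclic).
have j'k : j' != k by apply: contraFneq (tri _ _ _ eij ejj') => ->.
have k'j : k' != j.
  by apply: contraFneq (tri _ _ _ eik ekk') => ->; rewrite e_sym.
have j'k' : j' != k'.
  apply/eqP => jk'; rewrite -jk' in ek'k.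
  by case: (sq _ _ _ _ eij ejj' ek'k eki) => /eqP; rewrite 1?eq_sym ?(negPf j'i) ?(negPf kj).
have uniq5 : uniq [:: i; j; j'; k'; k].
  rewrite /= !inE !negb_or (adj_neq e_irr eij) (eq_sym i) j'i (eq_sym i) k'i.
  rewrite (adj_neq e_irr eik) (adj_neq e_irr ejj') (eq_sym j) k'j (eq_sym j) kj.
  by rewrite j'k' j'k (adj_neq e_irr ek'k).
have : t \in [:: i; j; j'; k'; k].
  have sub x : x \in [:: i; j; j'; k'; k] -> x \in enum 'I_n by rewrite mem_enum.
  have [|_ ->] := uniq_min_size uniq5 sub; first by rewrite size_enum_ord [X in (X <= _)%N]n5.
  by rewrite mem_enum.
rewrite !inE (negPf tj) /= => /or4P[]/eqP tE; rewrite tE in ej't.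
- by rewrite (tri _ _ _ eij ejj') in ej't.
- by rewrite e_irr in ej't.
- have /negP[] : ~~ path.cycle e [:: i; j; j'; k'; k] by apply: e_acyclic.
  by rewrite /= eij ejj' ej't ek'k eki.
- by case: (sq _ _ _ _ eij ejj' ej't eki) => /eqP; rewrite 1?eq_sym ?(negPf j'i) ?(negPf kj).
Qed.

End FiveVertices.

(** * Neighbour sums and degrees in the two extremal trees *)

Lemma star_sym n : symmetric (star_graph n).
Proof. by move=> x y; rewrite /star_graph orbC. Qed.

Lemma S31_sym n : symmetric (S31_graph n).
Proof. by move=> x y; rewrite /S31_graph orbC. Qed.

(** With [F] defined on [nat], degrees and eigenvector equations are evaluated at plain numerals. *)
Lemma sum_star_nbr (V : nmodType) m (F : nat -> V) (i : 'I_m.+1) :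
  \sum_(j | star_graph m.+1 i j) F j = if val i == 0%N then \sum_(k < m) F k.+1 else F 0%N.
Proof.
rewrite big_mkcond big_ord_recl /star_graph /=.
case: (i) => [[|k] Hk] /=; first by rewrite add0r.
by rewrite big1 ?addr0.
Qed.

Lemma sum_S31_nbr (V : nmodType) m (F : nat -> V) (i : 'I_m.+3) :
  \sum_(j | S31_graph m.+3 i j) F j =
  match val i with
  | 0 => F 1%N + \sum_(k < m) F k.+3
  | 1 => F 0%N + F 2%N
  | 2 => F 1%N
  | _ => F 0%N
  end.
Proof.
rewrite big_mkcond !big_ord_recl /S31_graph /S31_adj /=.
case: (i) => [[|[|[|k]]] Hk] /=; rewrite ?add0r //.
all: by rewrite big1 ?addr0.
Qed.

Lemma deg_sum n (e : rel 'I_n) i : deg e i = (\sum_(j | e i j) 1)%N.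
Proof. by rewrite /deg -sum1_card; apply: eq_bigl => j; rewrite inE. Qed.

Lemma sum_nbr_const_nat n (e : rel 'I_n) i c :
  (\sum_(j | e i j) c = deg e i * c)%N.
Proof. by rewrite deg_sum big_distrl /=; apply: eq_bigr => j _; rewrite mul1n. Qed.

Lemma deg_star m (i : 'I_m.+1) :
  deg (star_graph m.+1) i = if val i == 0%N then m else 1%N.
Proof.
rewrite deg_sum (@sum_star_nbr nat m (fun=> 1%N)).
by rewrite sum_nat_const card_ord muln1.
Qed.

Definition S31_deg m v := match v with 0 => m.+1 | 1 => 2 | _ => 1 end%N.

Lemma deg_S31 m (i : 'I_m.+3) : deg (S31_graph m.+3) i = S31_deg m i.
Proof.
rewrite deg_sum (@sum_S31_nbr nat m (fun=> 1%N)).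
case: i => [[|[|[|k]]] Hk] //=.
by rewrite sum_nat_const card_ord muln1.
Qed.

(** * Lower bounds for the two extremal spectral radii *)

Section Spectra.
Variable R : rcfType.

Lemma star_rho_ge m : (0 < m)%N -> Num.sqrt (m%:R - 1) <= rho_ABC R (star_graph m.+1).
Proof.
move=> m0; apply: eigenvalue_le_spectral_radius.
apply/(ABC_eigenvalueP (@star_sym _)).
have m1 : 1 <= m%:R :> R by rewrite ler1n.
have sm : 0 < Num.sqrt m%:R :> R by rewrite sqrtr_gt0; lra.
(* Every edge has weight [t / s], with [s] and [t] the roots of m and m - 1. The leaf equation is t
   = (t/s) s, and the centre equation t s = m (t/s). *)
exists (fun i : 'I_m.+1 => if val i == 0%N then Num.sqrt m%:R else 1).
  by exists ord0; rewrite /= gt_eqF.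
move=> i; set s := Num.sqrt m%:R in sm *; set t := Num.sqrt (m%:R - 1).
have sE : m%:R = s ^+ 2 by rewrite sqr_sqrtr; lra.
have entry : Num.sqrt ((m%:R + 1 - 2) / (m%:R * 1)) = t / s :> R.
  rewrite mulr1 (_ : m%:R + 1 - 2 = m%:R - 1 :> R); last by ring.
  by rewrite sqrtrM ?sqrtrV //; lra.
pose F k : R := t / s * (if k == 0%N then s else 1).
transitivity (\sum_(j | star_graph m.+1 i j) F j); last first.
  apply: eq_bigr => j eij; rewrite mxE eij /F; congr (_ * _).
  rewrite !deg_star -entry; move: eij; rewrite /star_graph.
  case: eqP => _; case: eqP => _ //= _.
  by rewrite [1%:R + _]addrC [1%:R * _]mulrC.
rewrite sum_star_nbr /F /=; case: eqP => _ /=.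
  by rewrite sumr_const card_ord -mulr_natr sE; field; rewrite gt_eqF.
by field; rewrite gt_eqF.
Qed.

(* The eigenvalue equation of S_{n-3,1} in x = lambda^2, with d = n - 2:
   (x - (d - 1)^2 / d) (2 x - 1) = x, multiplied by d / 2. *)
Definition S31_quadratic (d x : R) := d * x ^+ 2 - (d ^+ 2 - d + 1) * x + (d - 1) ^+ 2 / 2.

Lemma S31_eigenvalue m (lam : R) : (0 < m)%N -> 0 < lam ->
  S31_quadratic m.+1%:R (lam ^+ 2) = 0 ->
  eigenvalue (ABC_matrix R (S31_graph m.+3)) lam.
Proof.
move=> m0 lam0 q0; apply/(ABC_eigenvalueP (@S31_sym _)).
have m1 : 1 <= m%:R :> R by rewrite ler1n.
(* [s] is the weight of both edges at the vertex of degree 2, [l] that of the edges from the centre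
   to its leaves. *)
pose s : R := Num.sqrt 2^-1; pose l : R := Num.sqrt (m%:R / m.+1%:R).
have s2 : s ^+ 2 = 2^-1 by rewrite sqr_sqrtr // invr_ge0.
have s0 : 0 < s by rewrite sqrtr_gt0 invr_gt0.
have l2 : l ^+ 2 = m%:R / m.+1%:R by rewrite sqr_sqrtr // divr_ge0.
have ss : s * (2 * s * lam) = lam.
  by rewrite (_ : _ * _ = 2 * s ^+ 2 * lam); [rewrite s2; field | ring].
(* The vector is solved inwards from the far leaf 2 with value 1: the equations at 2, 1 and the
   other leaves determine the rest, using [s ^+ 2 = 1/2]. The centre equation is then the
   quadratic. *)
pose u : R := 2 * lam ^+ 2 - 1.
pose v k : R := match k with 0 => u | 1 => 2 * s * lam | 2 => 1 | _ => l * u / lam end.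
exists (fun i : 'I_m.+3 => v i).
  by exists (Ordinal (isT : 2 < m.+3)%N); rewrite /= oner_eq0.
move=> i.
pose c (a b : nat) : R := Num.sqrt (((S31_deg m a)%:R + (S31_deg m b)%:R - 2) /
  ((S31_deg m a)%:R * (S31_deg m b)%:R)).
transitivity (\sum_(j | S31_graph m.+3 i j) c i j * v j); last first.
  by apply: eq_bigr => j eij; rewrite mxE eij !deg_S31.
have dm : m.+1%:R = m%:R + 1 :> R by rewrite -natr1.
have c01 : c 0 1 = s.
  by rewrite /c /=; congr Num.sqrt; rewrite dm; field; lra.
have c10 : c 1 0 = s.
  by rewrite /c /=; congr Num.sqrt; rewrite dm; field; lra.
have c12 : c 1 2 = s.
  by rewrite /c /=; congr Num.sqrt; field.
have c21 : c 2 1 = s.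
  by rewrite /c /=; congr Num.sqrt; field.
have c03 k : c 0 k.+3 = l.
  by rewrite /c /=; congr Num.sqrt; rewrite dm; field; lra.
have c30 k : c k.+3 0 = l.
  by rewrite /c /=; congr Num.sqrt; rewrite dm; field; lra.
rewrite (@sum_S31_nbr R m (fun k => c i k * v k)).
case: (i) => [[|[|[|k]]] Hk] /=; rewrite ?c01 ?c10 ?c12 ?c21 ?c30.
- under eq_bigr do rewrite c03.
  rewrite sumr_const card_ord -[X in _ + X]mulr_natr.
  rewrite ss.
  have -> : l * (l * u / lam) = l ^+ 2 * u / lam by ring.
  rewrite l2 dm; apply: (mulfI (_ : lam * (m%:R + 1) != 0)).
    by rewrite mulf_neq0 ?gt_eqF //; lra.
  move: q0; rewrite /S31_quadratic dm => q0.
  have -> : lam * (m%:R + 1) * (lam + m%:R / (m%:R + 1) * u / lam * m%:R) =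
      (m%:R + 1) * lam ^+ 2 + m%:R ^+ 2 * u.
    by field; rewrite gt_eqF //=; lra.
  rewrite /u; nra.
- rewrite /u; ring.
- by rewrite ss mulr1.
- by field; rewrite gt_eqF.
Qed.

(** The quadratic is nonnegative at d = m + 1, so it has a root in [b, d], whose square root is an
    eigenvalue. The root is kept in the conclusion for the later discussion of the case x = b. *)
Lemma S31_rho_ge m (b : R) : (0 < m)%N -> 1 <= b <= m.+1%:R ->
  S31_quadratic m.+1%:R b <= 0 ->
  exists2 x, S31_quadratic m.+1%:R x = 0 /\ b <= x & Num.sqrt x <= rho_ABC R (S31_graph m.+3).
Proof.
move=> m0 /andP[b1 bd] qb; set d : R := m.+1%:R in bd qb *.
have d2 : 2 <= d by rewrite (ler_nat R 2).
pose p : {poly R} := d *: 'X^2 - (d ^+ 2 - d + 1) *: 'X + ((d - 1) ^+ 2 / 2)%:P.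
have pE x : p.[x] = S31_quadratic d x.
  by rewrite /p !(hornerD, hornerN, hornerZ, hornerXn, hornerX, hornerC).
have [|x] := @poly_ivt R p b d bd.
  rewrite !pE qb /S31_quadratic; nra.
move=> /andP[bx xd] /rootP; rewrite pE => qx.
exists x => //; apply: eigenvalue_le_spectral_radius; apply: S31_eigenvalue => //.
  by rewrite sqrtr_gt0; lra.
by rewrite sqr_sqrtr; lra.
Qed.

End Spectra.

(** * Comparison of the spectral radii *)

(** Isolates the sum of the neighbours' degrees as a natural number, ready for counting. *)
Lemma rho_ABC_local_bound (R : rcfType) n (e : rel 'I_n) :
  symmetric e -> (forall i, 0 < deg e i)%N -> 0 < rho_ABC R e ->
  exists2 S : {set 'I_n}, S != set0 & forall i, i \in S ->
    let d : R := (deg e i)%:R in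
    let s : R := d * (d - 2) + (\sum_(j | e i j) deg e j)%:R in
    rho_ABC R e ^+ 2 * d <= s /\
    (s <= rho_ABC R e ^+ 2 * d -> forall j, e i j -> j \in S).
Proof.
move=> e_sym e_deg rho0.
have ev : eigenvalue (ABC_matrix R e) (rho_ABC R e).
  by apply: eigenvalue_spectral_radius; rewrite -/(rho_ABC R e) gt_eqF.
have [S S0 SP] := ABC_eigenvalue_local_bound e_sym e_deg rho0 ev.
exists S => // i /SP; rewrite /=.
have -> // : \sum_(j | e i j) ((deg e i)%:R + (deg e j)%:R - 2) =
  (deg e i)%:R * ((deg e i)%:R - 2) + (\sum_(j | e i j) deg e j)%:R :> R.
rewrite natr_sum -sum_nbr_const -big_split /=; apply: eq_bigr => j _; ring.
Qed.

(** The star has squared radius at least m + 1, while the local bound at each of the four kinds of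
    vertices of [S31_graph] keeps the square below m + 1. *)
Lemma rho_S31_lt_star (R : rcfType) m : (0 < m)%N ->
  rho_ABC R (S31_graph m.+3) < rho_ABC R (star_graph m.+3).
Proof.
move=> m0; have m1 : 1 <= m%:R :> R by rewrite ler1n.
apply: lt_le_trans (star_rho_ge R (isT : 0 < m.+2)%N).
rewrite -natr1 addrK -natr1 ltNge; apply/negP => le_rho.
have rho0 : 0 < rho_ABC R (S31_graph m.+3).
  by apply: lt_le_trans le_rho; rewrite sqrtr_gt0; lra.
have rho2 : m%:R + 1 <= rho_ABC R (S31_graph m.+3) ^+ 2.
  rewrite -(@sqr_sqrtr R (m%:R + 1)); last lra.
  by rewrite ler_sqr ?nnegrE ?sqrtr_ge0 // ltW.
have e_deg i : (0 < deg (S31_graph m.+3) i)%N.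
  by rewrite deg_S31; case: (nat_of_ord i) => [|[|]].
have [S /set0Pn[i iS] SP] := rho_ABC_local_bound (@S31_sym _) e_deg rho0.
have [{SP iS} + _] := SP i iS.
under eq_bigr do rewrite deg_S31.
rewrite deg_S31 (@sum_S31_nbr nat m (S31_deg m)).
move: (_ ^+ 2) rho2 => x {rho0 le_rho e_deg S}.
case: i => [[|[|[|k]]] Hk] /=.
- rewrite sum_nat_const card_ord muln1 natrD -natr1; nra.
- rewrite natrD -natr1; nra.
- nra.
- rewrite -natr1; nra.
Qed.

Lemma rho_tree_lt_S31 (R : rcfType) m (e : rel 'I_m.+3) : (0 < m)%N ->
  symmetric e -> irreflexive e -> acyclic_graph e ->
  (forall i, 0 < deg e i <= m)%N ->
  rho_ABC R e < rho_ABC R (S31_graph m.+3).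
Proof.
move=> m0 e_sym e_irr e_acyc e_deg.
have m1 : 1 <= m%:R :> R by rewrite ler1n.
have dm : m.+1%:R = m%:R + 1 :> R by rewrite -natr1.
rewrite ltNge; apply/negP => le_rho.
(* At m = 1 the general formula gives 2, where the quadratic is positive. The value 1 suffices
   there, since all degrees are then 1 and the local bound gives [y <= 0]. *)
pose b : R := if m == 1%N then 1 else m%:R - 1 + 2 / m%:R.
have mm (m2 : (2 <= m)%N) : 2 <= m%:R :> R by rewrite (ler_nat R 2).
have bE : (2 <= m)%N -> exists2 r : R, r * m%:R = 2 & b = m%:R - 1 + r.
  move=> m2; exists (2 / m%:R); first by field; lra.
  by rewrite /b gtn_eqF.
have qb : S31_quadratic m.+1%:R b <= 0 ?= iff (m == 2%N).
  rewrite /b; have [mE|m_neq1] := eqVneq m 1%N.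
    by apply/leifP; rewrite mE /= /S31_quadratic; nra.
  have m_gt1 : (2 <= m)%N by rewrite ltn_neqAle eq_sym m_neq1.
  have m2 := mm m_gt1.
  have -> : S31_quadratic m.+1%:R (m%:R - 1 + 2 / m%:R) =
      - ((m%:R - 2) * (m%:R ^+ 3 + 4) / (2 * m%:R ^+ 2)) :> R.
    by rewrite /S31_quadratic dm; field; lra.
  apply/leifP; have [->|m_neq2] := eqVneq m 2%N; first by rewrite subrr !mul0r oppr0.
  have m_gt2 : 2 < m%:R :> R by rewrite (ltr_nat R 2) ltn_neqAle eq_sym m_neq2.
  have m3_gt0 : 0 < m%:R ^+ 3 :> R by apply: exprn_gt0; lra.
  have m2_gt0 : 0 < m%:R ^+ 2 :> R by apply: exprn_gt0; lra.
  by rewrite oppr_lt0; apply: divr_gt0; first apply: mulr_gt0; lra.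
have b_bd : 1 <= b <= m.+1%:R.
  rewrite dm; have [m2|m_lt2] := leqP 2 m.
    by have [[r rm ->] m2'] := (bE m2, mm m2); nra.
  have -> : b = 1 by rewrite /b eqn_leq m0 -ltnS m_lt2.
  by lra.
have [x [qx bx] x_le] := S31_rho_ge m0 b_bd (leif_le qb).
have rho0 : 0 < rho_ABC R e.
  by apply: lt_le_trans (le_trans x_le le_rho); rewrite sqrtr_gt0; lra.
have x_rho2 : x <= rho_ABC R e ^+ 2.
  rewrite -(@sqr_sqrtr R x); last lra.
  by rewrite ler_sqr ?nnegrE ?sqrtr_ge0 ?(le_trans x_le le_rho) // ltW.
have e_deg0 i : (0 < deg e i)%N by case/andP: (e_deg i).
have [S /set0Pn[i iS] SP] := rho_ABC_local_bound e_sym e_deg0 rho0.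
move: (_ ^+ 2) SP x_rho2 => y SP xy.
have sum_le k : (\sum_(j | e k j) deg e j <= m.+2)%N.
  by apply: (sum_nbr_deg_lt e_sym e_irr e_acyc).
(* A leaf in [S] would force [y <= m - 1], which is below [b]. *)
have leaf_sum k : deg e k = 1%N -> (\sum_(j | e k j) deg e j <= m)%N.
  move=> dk; apply: (@leq_trans (\sum_(j | e k j) m)).
    by apply: leq_sum => j _; case/andP: (e_deg j).
  by rewrite sum_nbr_const_nat dk mul1n.
have leaf_lt k : k \in S -> deg e k = 1%N -> y <= m%:R - 1.
  move=> kS dk; have [] := SP k kS; rewrite dk => + _.
  have := leaf_sum k dk; rewrite -(ler_nat R); lra.
have [m_ge2|m_lt2] := leqP 2 m; last first.
  have di : deg e i = 1%N by have := e_deg i; lia.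
  have : m%:R <= 1 :> R by rewrite (ler_nat R m 1).
  by have := leaf_lt i iS di; move: b_bd => /andP[b1 _]; lra.
have m2 := mm m_ge2; have [r rm bE'] := bE m_ge2.
have r0 : 0 < r by nra.
have r1 : r <= 1 by nra.
have S_bulk k : k \in S -> (2 <= deg e k)%N.
  move=> kS; rewrite ltn_neqAle e_deg0 andbT eq_sym; apply/eqP => /(leaf_lt k kS).
  lra.
have y_le : y <= b.
  have [+ _] := SP i iS; have := sum_le i; rewrite -(ler_nat R) -(natr1 m.+1) dm.
  have := S_bulk i iS; rewrite -(ler_nat R 2) => d2.
  have : (deg e i)%:R <= m%:R :> R by rewrite ler_nat; case/andP: (e_deg i).
  rewrite bE' => dm' s_le y_le'.
  (* With D the degree of [i] and r m = 2, this product equals b D - (D (D - 2) + m + 2); it is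
     nonnegative since 2 <= D <= m and r <= 1. *)
  have : 0 <= (m%:R - (deg e i)%:R) * ((deg e i)%:R - 1 - r) by apply: mulr_ge0; lra.
  rewrite -(@ler_pM2r R (deg e i)%:R); nra.
(* The chain b <= x <= y <= b collapses, so [b] is a root of the quadratic, which happens only for m
   = 2. *)
have yb : y = b by lra.
have xb : x = b by lra.
have mE : m = 2%N by have [_ +] := qb; rewrite -xb qx eqxx => /esym/eqP.
have y2 : y = 2 by rewrite yb /b mE /=; field.
have S_deg k : k \in S -> deg e k = 2%N.
  move=> kS; apply/eqP; rewrite eqn_leq S_bulk // andbT.
  by rewrite -[X in (_ <= X)%N]mE; case/andP: (e_deg k).
have S_sum k : k \in S -> (\sum_(j | e k j) deg e j)%N = 4%N.
  move=> kS; apply/eqP; rewrite eqn_leq (leq_trans (sum_le k)) ?mE //=.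
  by have [+ _] := SP k kS; rewrite S_deg // y2 -(ler_nat R); lra.
apply: (deg2_ball_false e_sym e_irr e_acyc (i := i)); rewrite ?S_deg ?mE //.
(* At [i] both sides of the local bound equal 4, so the equality case puts the neighbours of [i] in
   [S]. *)
move=> j eij; have jS : j \in S.
  by have [_] := SP i iS; apply=> //; rewrite S_deg // S_sum // y2; lra.
by rewrite S_deg ?S_sum.
Qed.

Theorem theorem3p1 (R : rcfType) (n : nat) (hn : (4 <= n)%N) (T : rel 'I_n) :
  is_tree T -> ~ graph_iso T (star_graph n) -> ~ graph_iso T (S31_graph n) ->
  rho_ABC R T < rho_ABC R (S31_graph n) /\
  rho_ABC R (S31_graph n) < rho_ABC R (star_graph n).
Proof.
case: n hn T => [|[|[|m]]] // m0 T [[T_sym T_irr] [T_conn T_acyc]] not_star not_S31.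
split; last exact: rho_S31_lt_star.
apply: rho_tree_lt_S31 => // i.
have T_deg j : (0 < deg T j)%N.
  apply/deg_gt0P; have [k jk] : exists k, j != k.
    have [->|j0] := eqVneq j ord0; last by exists ord0.
    by exists ord_max.
  exact: exists_nbr (T_conn j k) jk.
(* Degrees are at most n - 1; the values n - 1 and n - 2 give the two excluded trees, leaving at
   most m = n - 3. *)
rewrite T_deg /=; have := deg_lt T_irr i.
rewrite !ltnS leq_eqVlt => /orP[/eqP di|]; first by
  case: not_star; apply: (star_of_deg T_sym T_irr T_acyc di).
rewrite ltnS leq_eqVlt => /orP[/eqP di|//].
by case: not_S31; apply: (S31_of_deg T_sym T_irr T_acyc _ T_deg di).
Qed.
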